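(* Let $C$ be a nonempty closed convex subset of a CAT(0) space $(X,d)$, with $C$ a Chebyshev set (so that the metric projection $P_C:X\to C$ is defined). Then the metric projection $P_C$ onto $C$ is a firmly nonexpansive mapping.
   Context: A geodesic in a metric space $(X,d)$ is a map $\gamma:[a,b]\to X$ with $d(\gamma(s),\gamma(t))=|s-t|$ for all $s,t\in[a,b]$; $X$ is a geodesic space if any two distinct points are the endpoints $\gamma(a),\gamma(b)$ of some geodesic. A CAT(0) space is a geodesic space such that for all $x,y,z\in X$ and all $m\in X$ with $d(x,m)=d(y,m)=\frac12d(x,y)$ one has $d(z,m)^2\le\frac12d(z,x)^2+\frac12d(z,y)^2-\frac14d(x,y)^2$. In a CAT(0) space, for $x,y\in X$ and $\lambda\in[0,1]$, $(1-\lambda)x\oplus\lambda y$ denotes the unique point $z$ with $d(x,z)=\lambda d(x,y)$ and $d(y,z)=(1-\lambda)d(x,y)$. A subset $C$ is convex if $(1-\lambda)x\oplus\lambda y\in C$ for all $x,y\in C$, $\lambda\in[0,1]$. A subset $C$ of $X$ is a Chebyshev set if for each $x\in X$ there is a unique $z\in C$ with $d(x,z)=d(x,C):=\inf\{d(x,y)\mid y\in C\}$; the metric projection $P_C:X\to C$ then assigns this $z$ to $x$. For $C\subseteq X$, a map $T:C\to X$ is firmly nonexpansive if $d(Tx,Ty)\le d((1-\lambda)x\oplus\lambda Tx,(1-\lambda)y\oplus\lambda Ty)$ for all $x,y\in C$ and all $\lambda\in(0,1)$. *)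

(* Defs.v *)
From mathcomp Require Import all_boot all_order all_algebra.
From mathcomp Require Import mathcomp_extra boolp classical_sets set_interval.
From mathcomp Require Import reals topology.
From mathcomp Require Import lra.

Set Implicit Arguments.
Unset Strict Implicit.
Unset Printing Implicit Defensive.
Import Order.TTheory GRing.Theory Num.Theory.
Local Open Scope classical_set_scope.
Local Open Scope ring_scope.

(* A map [a, b] -> X is represented by a total function R -> X of which only
   the values on [a, b] matter; the condition a <= b excludes the empty
   interval, on which the isometry condition would be vacuous. *)
Definition is_geodesic (R : realType) (X : metricType R) (a b : R)
    (gamma : R -> X) : Prop :=
  a <= b /\ forall s t : R, s \in `[a, b] -> t \in `[a, b] ->
    mdist (gamma s) (gamma t) = `|s - t|.

Definition geodesic_space (R : realType) (X : metricType R) : Prop :=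
  forall x y : X, x <> y -> exists (a b : R) (gamma : R -> X),
    [/\ is_geodesic a b gamma, gamma a = x & gamma b = y].

Definition CAT0 (R : realType) (X : metricType R) : Prop :=
  geodesic_space X /\
  forall x y z m : X,
    mdist x m = 2^-1 * mdist x y -> mdist y m = 2^-1 * mdist x y ->
    mdist z m ^+ 2 <=
      2^-1 * mdist z x ^+ 2 + 2^-1 * mdist z y ^+ 2 - 4^-1 * mdist x y ^+ 2.

(* The points z entitled to the name (1 - l) x (+) l y. *)
Definition is_geo_comb (R : realType) (X : metricType R) (l : R) (x y z : X)
    : Prop :=
  mdist x z = l * mdist x y /\ mdist y z = (1 - l) * mdist x y.

(* (1 - l) x (+) l y.  In a CAT(0) space and for 0 <= l <= 1 the point exists
   and is unique (geo_combP, is_geo_comb_uniq), so the default value x of xget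
   is never used. *)
Definition geo_comb (R : realType) (X : metricType R) (l : R) (x y : X) : X :=
  xget x [set z | is_geo_comb l x y z].

Definition geo_convex (R : realType) (X : metricType R) (C : set X) : Prop :=
  forall (x y : X) (l : R), C x -> C y -> 0 <= l <= 1 -> C (geo_comb l x y).

Definition dist_set (R : realType) (X : metricType R) (x : X) (C : set X) : R :=
  inf [set mdist x y | y in C].

Definition is_nearest (R : realType) (X : metricType R) (C : set X) (x z : X)
    : Prop :=
  C z /\ mdist x z = dist_set x C.

Definition chebyshev (R : realType) (X : metricType R) (C : set X) : Prop :=
  forall x : X, exists! z : X, is_nearest C x z.

(* P_C; the default value x of xget is irrelevant for a Chebyshev set C
   (metric_projP). *)
Definition metric_proj (R : realType) (X : metricType R) (C : set X) (x : X)
    : X :=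
  xget x [set z | is_nearest C x z].

(* A map T : D -> X is represented by a total function X -> X of which only the
   values on D matter. *)
Definition firmly_nonexpansive (R : realType) (X : metricType R) (D : set X)
    (T : X -> X) : Prop :=
  forall (x y : X) (l : R), D x -> D y -> 0 < l < 1 ->
    mdist (T x) (T y) <= mdist (geo_comb l x (T x)) (geo_comb l y (T y)).

Lemma is_geo_comb_exists (R : realType) (X : metricType R) (l : R) (x y : X) :
  geodesic_space X -> 0 <= l <= 1 -> exists z, is_geo_comb l x y z.
Proof.
move=> gX; case/andP=> l0 l1; have [<-|xy] := pselect (x = y).
  by exists x; split; rewrite mdistxx mulr0.
have [a [b [g [[ab gi] <- <-]]]] := gX _ _ xy.
exists (g (a + l * (b - a))).
have ain : a \in `[a, b] by rewrite in_itv /= lexx ab.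
have bin : b \in `[a, b] by rewrite in_itv /= lexx ab.
have ba : 0 <= b - a by rewrite subr_ge0.
have cin : a + l * (b - a) \in `[a, b].
  rewrite in_itv /=; apply/andP; split; nra.
rewrite /is_geo_comb !gi //; rewrite (distrC a b) (ger0_norm ba); split.
  by rewrite distrC addrC addKr ger0_norm // mulr_ge0.
by rewrite ger0_norm; nra.
Qed.

Lemma is_geo_comb_uniq (R : realType) (X : metricType R) (l : R)
    (x y z z' : X) :
  CAT0 X -> 0 <= l <= 1 ->
  is_geo_comb l x y z -> is_geo_comb l x y z' -> z = z'.
Proof.
move=> [gX cn] /andP[l0 l1] [xz yz] [xz' yz'].
have h : 0 <= (2^-1 : R) <= 1 by rewrite invr_ge0 ler0n invf_le1 ?ltr0n // ler1n.
have [m [zm z'm]] := is_geo_comb_exists z z' gX h.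
have z'm' : mdist z' m = 2^-1 * mdist z z' by rewrite z'm; congr (_ * _); lra.
have := cn _ _ x _ zm z'm'; have := cn _ _ y _ zm z'm'.
rewrite xz xz' yz yz' => ym xm.
have := metric_triangle x m y; rewrite (metric_sym m y).
have := mdist_ge0 x m; have := mdist_ge0 y m; have := mdist_ge0 x y.
have := mdist_ge0 z z'.
move: ym xm; set p := mdist x m; set q := mdist y m; set D := mdist x y.
set e := mdist z z' => ym xm e0 D0 q0 p0 tri.
apply: mdist_positivity; rewrite -/e.
have pD : p <= l * D.
  by rewrite -(@ler_pXn2r _ 2) ?nnegrE ?mulr_ge0 //; nra.
have qD : q <= (1 - l) * D.
  rewrite -(@ler_pXn2r _ 2) ?nnegrE ?mulr_ge0 ?subr_ge0 //; nra.
have pE : p = l * D by lra.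
by apply/eqP; rewrite -sqrf_eq0 eq_le sqr_ge0 andbT; rewrite pE in xm; lra.
Qed.

Lemma geo_combP (R : realType) (X : metricType R) (l : R) (x y : X) :
  CAT0 X -> 0 <= l <= 1 -> is_geo_comb l x y (geo_comb l x y).
Proof.
move=> [gX _] l01; have [z hz] := is_geo_comb_exists x y gX l01.
exact: (@xgetPex _ x [set z | is_geo_comb l x y z] (ex_intro _ z hz)).
Qed.

Lemma metric_projP (R : realType) (X : metricType R) (C : set X) (x : X) :
  chebyshev C -> is_nearest C x (metric_proj C x).
Proof.
move=> /(_ x)[z [hz _]].
exact: (@xgetPex _ x [set z | is_nearest C x z] (ex_intro _ z hz)).
Qed.

(* Main.v *)
Require Import Defs.
From mathcomp Require Import all_boot all_order all_algebra.
From mathcomp Require Import boolp classical_sets reals topology.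
From mathcomp Require Import lra.

Set Implicit Arguments.
Unset Strict Implicit.
Import Order.TTheory GRing.Theory Num.Theory.
Local Open Scope classical_set_scope.
Local Open Scope ring_scope.

(** Write [P] for the projection.  Every point [c] of [C] satisfies the obtuse
    angle inequality [d(u,c)^2 >= d(u,Pu)^2 + d(Pu,c)^2].  Added up for [u], [Pv]
    and for [v], [Pu], and compared with the quadrilateral inequality of a CAT(0)
    space, it gives [d(Pu,Pv) <= d(u,v)].  Firmness follows since every point of
    the geodesic from [x] to [Px] still has [Px] as a nearest point. *)

Lemma geo_comb_midpoint (R : realType) (X : metricType R) (x y : X) :
  CAT0 X -> let m := geo_comb 2^-1 x y in
  mdist x m = 2^-1 * mdist x y /\ mdist y m = 2^-1 * mdist x y.
Proof.
move=> catX m; have h : 0 <= (2^-1 : R) <= 1 by lra.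
by have [-> ->] := geo_combP x y catX h; split=> //; lra.
Qed.

(** Let [m] be the midpoint of [u] and [q]. The triangle inequality through [m] gives d(v,p)^2 <= 2
    d(v,m)^2 + 2 d(p,m)^2, and the CAT(0) inequality bounds each square on the right. *)
Lemma CAT0_quadrilateral (R : realType) (X : metricType R) (u v p q : X) :
  CAT0 X ->
  mdist u q ^+ 2 + mdist v p ^+ 2 <=
    mdist u p ^+ 2 + mdist v q ^+ 2 + mdist u v ^+ 2 + mdist p q ^+ 2.
Proof.
move=> catX; have [um qm] := geo_comb_midpoint u q catX.
set m := geo_comb _ _ _ in um qm.
have := catX.2 u q v m um qm; have := catX.2 u q p m um qm.
have := metric_triangle v m p; rewrite (metric_sym m p).
rewrite (metric_sym v u) (metric_sym p u).
have := mdist_ge0 v p; have := mdist_ge0 v m; have := mdist_ge0 p m.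
have := sqr_ge0 (mdist v m - mdist p m); nra.
Qed.

(** Lets the error term of [obtuse_angle_approx] tend to 0: for positive [c] and [e], any n > c / e
    has c / e < n < 2^n. *)
Lemma ler_addXn_half (R : realType) (a b c : R) :
  (forall n, a <= b + c * 2^-1 ^+ n) -> a <= b.
Proof.
move=> h; have [c0|c0] := leP c 0.
  by have := h 0; rewrite expr0 mulr1; lra.
apply/ler_addgt0Pr => e e0.
have [n cn] : exists n, c / e < n%:R.
  by exists (Num.truncn (c / e)).+1; exact: truncnS_gt.
apply: (le_trans (h n)); rewrite lerD2l exprVn ler_pdivrMr ?exprn_gt0 //.
rewrite ltr_pdivrMr // in cn.
apply: (le_trans (ltW cn)); rewrite mulrC ler_pM2l //.
by rewrite -natrX ler_nat ltnW // ltn_expl.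
Qed.

Section NearestPoint.
Context {R : realType} {X : metricType R}.
Implicit Types (C : set X) (u v p q c : X).

Lemma is_nearest_le {C u p c} : is_nearest C u p -> C c ->
  mdist u p <= mdist u c.
Proof.
move=> [_ ->] Cc; apply: ge_inf; last by exists c.
by exists 0 => _ [y _ <-]; exact: mdist_ge0.
Qed.

(* The constant [k = 1 - 2^-n] is the n-th iterate of [k |-> (1 + k) / 2]: apply
   the inequality with [k] to the midpoint of [p] and [c]. *)
Lemma obtuse_angle_approx C u p (n : nat) c :
  CAT0 X -> geo_convex C -> C p ->
  (forall y, C y -> mdist u p <= mdist u y) -> C c ->
  mdist u p ^+ 2 + mdist p c ^+ 2 <=
    mdist u c ^+ 2 + mdist p c ^+ 2 * 2^-1 ^+ n.
Proof.
move=> catX cvxC Cp up; elim: n c => [|n IHn] c Cc.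
  rewrite expr0 mulr1 lerD2r; have := up c Cc; have := mdist_ge0 u p; nra.
have [pm cm] := geo_comb_midpoint p c catX.
have Cm : C (geo_comb 2^-1 p c) by apply: cvxC => //; lra.
have := IHn _ Cm; have := catX.2 p c u _ pm cm.
by rewrite (exprS _ n) pm; set t := 2^-1 ^+ n; lra.
Qed.

Lemma obtuse_angle {C u p c} :
  CAT0 X -> geo_convex C -> C p ->
  (forall y, C y -> mdist u p <= mdist u y) -> C c ->
  mdist u p ^+ 2 + mdist p c ^+ 2 <= mdist u c ^+ 2.
Proof.
move=> catX cvxC Cp up Cc; apply: ler_addXn_half => n.
exact: (obtuse_angle_approx n catX cvxC).
Qed.

(** Here [p] and [q] are any minimizers on [C], so that [u] and [v] can be taken on the geodesics
    from [x] to [Px] and from [y] to [Py], with [p = Px] and [q = Py]. *)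
Lemma nearest_nonexpansive C u v p q :
  CAT0 X -> geo_convex C -> C p -> C q ->
  (forall y, C y -> mdist u p <= mdist u y) ->
  (forall y, C y -> mdist v q <= mdist v y) ->
  mdist p q <= mdist u v.
Proof.
move=> catX cvxC Cp Cq up vq.
rewrite -(@ler_pXn2r _ 2) ?nnegrE ?mdist_ge0 //.
have := obtuse_angle catX cvxC Cp up Cq.
have := obtuse_angle catX cvxC Cq vq Cp.
have := CAT0_quadrilateral u v p q catX.
by rewrite (metric_sym q p); lra.
Qed.

(** With [z] the point on the geodesic, d(x,z) + d(z,p) = d(x,p) <= d(x,c) <= d(x,z) + d(z,c);
    cancel d(x,z). *)
Lemma nearest_geo_comb C x p (l : R) c :
  CAT0 X -> 0 <= l <= 1 -> is_nearest C x p -> C c ->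
  mdist (geo_comb l x p) p <= mdist (geo_comb l x p) c.
Proof.
move=> catX l01 xp Cc; have [xz pz] := geo_combP x p catX l01.
have := is_nearest_le xp Cc; have := metric_triangle x (geo_comb l x p) c.
by rewrite (metric_sym (geo_comb l x p) p) xz pz; lra.
Qed.

End NearestPoint.

Theorem proposition3p1 (R : realType) (X : metricType R) (C : set X) :
  CAT0 X -> C !=set0 -> closed C -> geo_convex C -> chebyshev C ->
  firmly_nonexpansive setT (metric_proj C).
Proof.
move=> catX _ _ cvxC chebC x y l _ _ /andP[/ltW l0 /ltW l1].
have l01 : 0 <= l <= 1 by rewrite l0.
have xp := metric_projP x chebC; have yq := metric_projP y chebC.
apply: (nearest_nonexpansive (C := C)) => //; first exact: xp.1.
- exact: yq.1.
- by move=> c; exact: nearest_geo_comb.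
- by move=> c; exact: nearest_geo_comb.
Qed.
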